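(* Let $\mathcal{H}$ be a real Hilbert space and let $n\ge 2$ be an integer. For each $i\in\{1,\ldots,n\}$, let $T_i:\mathcal{H}\to\mathcal{H}$ be conically $\theta_i$-averaged, where $\theta_i>0$, and let $(x_{i,k})_{k=0}^{\infty}$ be a sequence in $\mathcal{H}$. Let $x_1,\ldots,x_n,y\in\mathcal{H}$ and suppose that, as $k\to\infty$, \begin{align*} &\forall i\in\{1,\ldots,n\},\quad x_{i,k}\rightharpoonup x_i,\\ &\forall i\in\{1,\ldots,n\},\quad T_i(x_{i,k})\rightharpoonup 2\theta_iy+(1-2\theta_i)x_i,\\ &\sum_{i=1}^n\frac{x_{i,k}-T_i(x_{i,k})}{2\theta_i}\to-ny+\sum_{i=1}^nx_i,\\ &\forall i,j\in\{1,\ldots,n\},\quad (x_{i,k}-x_{j,k})-\left(\frac{x_{i,k}-T_i(x_{i,k})}{2\theta_i}-\frac{x_{j,k}-T_j(x_{j,k})}{2\theta_j}\right)\to 0. \end{align*} Then $T_i(x_i)=2\theta_iy+(1-2\theta_i)x_i$ for all $i\in\{1,\ldots,n\}$.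
   Context: The symbols $\rightharpoonup$ and $\to$ denote weak and strong (norm) convergence in $\mathcal{H}$, respectively. A mapping $R:\mathcal{H}\to\mathcal{H}$ is nonexpansive if $\|R(x)-R(y)\|\le\|x-y\|$ for all $x,y\in\mathcal{H}$. For $\theta>0$, a mapping $T:\mathcal{H}\to\mathcal{H}$ is conically $\theta$-averaged if there exists a nonexpansive mapping $R:\mathcal{H}\to\mathcal{H}$ such that $T=(1-\theta)\operatorname{Id}+\theta R$, where $\operatorname{Id}$ is the identity mapping on $\mathcal{H}$. *)

(* Defs.v *)
From HB Require Import structures.
From mathcomp Require Import all_boot all_order all_algebra.
From mathcomp Require Import all_classical all_reals all_analysis.
Import Order.TTheory GRing.Theory Num.Theory.
Import numFieldNormedType.Exports.

Set Implicit Arguments.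
Unset Strict Implicit.
Unset Printing Implicit Defensive.

Local Open Scope classical_set_scope.
Local Open Scope ring_scope.

(* A real Hilbert space is a complete normed module [H] together with a
   symmetric positive definite bilinear form [dot] (a [{dot H for idfun}])
   that induces the norm of [H]. *)
Definition induces_norm (R : realType) (H : normedModType R)
    (dot : {dot H for idfun}) : Prop :=
  forall u : H, `|u| = Num.sqrt (dot u u).

Definition weak_cvg (R : realType) (H : normedModType R)
    (u : nat -> H) (l : H) : Prop :=
  forall f : {linear H -> R^o}, continuous f ->
    (fun k => f (u k)) @ \oo --> f l.

Definition nonexpansive (R : realType) (H : normedModType R)
    (N : H -> H) : Prop :=
  forall x y : H, `|N x - N y| <= `|x - y|.

Definition conically_averaged (R : realType) (H : normedModType R)
    (theta : R) (T : H -> H) : Prop :=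
  exists2 N : H -> H, nonexpansive N &
    forall x : H, T x = (1 - theta) *: x + theta *: N x.

(* Main.v *)
(** Put [F_i = (Id - T_i) / (2 theta_i)]. Writing [T_i] through its nonexpansive
    map [N_i] gives [F_i = (Id - N_i) / 2], which is firmly nonexpansive:
    [<F_i u - F_i v, (u - F_i u) - (v - F_i v)> >= 0].
    Let [p_i(k) = F_i(x_i(k))] and [q_i(k) = x_i(k) - p_i(k)], so [p_i(k)]
    converges weakly to [x_i - y], every [q_i(k)] converges weakly to [y],
    [sum_i p_i(k)] converges strongly and the [q_i(k)] differ by strongly null
    sequences. In the sum over [i] of the monotonicity inequalities between
    [x_i(k)] and [x_i], replace every [q_i(k)] by a single one: the error terms
    and the remaining product pair a strongly convergent factor with a weakly
    convergent, hence bounded, one. In the limit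
    [0 <= sum_i <x_i - y - F_i x_i, y - (x_i - F_i x_i)>
        = - sum_i |x_i - y - F_i x_i|^2]. *)
Require Import Defs.
From HB Require Import structures.
From mathcomp Require Import all_boot all_order all_algebra.
From mathcomp Require Import all_classical all_reals all_analysis.
From mathcomp Require Import lra.
Import Order.TTheory GRing.Theory Num.Theory.
Import numFieldNormedType.Exports.
Local Open Scope classical_set_scope.
Local Open Scope ring_scope.

Lemma dot_sym {R : realType} {H : lmodType R} {dot : {dot H for idfun}}
  (u v : H) : dot u v = dot v u.
Proof. by rewrite hermC expr0 mul1r. Qed.

Lemma dotDr {R : realType} {H : lmodType R} {dot : {dot H for idfun}}
    (u v w : H) :
  dot u (v + w) = dot u v + dot u w.
Proof. exact: linearDr. Qed.

Lemma dotZr {R : realType} {H : lmodType R} {dot : {dot H for idfun}}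
    (c : R) (u v : H) :
  dot u (c *: v) = c * dot u v.
Proof. exact: linearZr_LR. Qed.

Lemma dotNr {R : realType} {H : lmodType R} {dot : {dot H for idfun}}
    (u v : H) :
  dot u (- v) = - dot u v.
Proof. exact: linearNr. Qed.

Lemma dotBr {R : realType} {H : lmodType R} {dot : {dot H for idfun}}
    (u v w : H) :
  dot u (v - w) = dot u v - dot u w.
Proof. exact: linearBr. Qed.

Lemma dot0r {R : realType} {H : lmodType R} {dot : {dot H for idfun}}
    (u : H) : dot u 0 = 0.
Proof. exact: linear0r. Qed.

Lemma dot_sumr {R : realType} {H : lmodType R} {dot : {dot H for idfun}}
    (I : Type) (r : seq I) (u : H) (F : I -> H) :
  dot u (\sum_(i <- r) F i) = \sum_(i <- r) dot u (F i).
Proof. exact: linear_sumr. Qed.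

Lemma dotDl {R : realType} {H : lmodType R} {dot : {dot H for idfun}}
    (u v w : H) :
  dot (u + v) w = dot u w + dot v w.
Proof. by rewrite !(dot_sym _ w) dotDr. Qed.

Lemma dotZl {R : realType} {H : lmodType R} {dot : {dot H for idfun}}
    (c : R) (u v : H) :
  dot (c *: u) v = c * dot u v.
Proof. by rewrite !(dot_sym _ v) dotZr. Qed.

Lemma dotNl {R : realType} {H : lmodType R} {dot : {dot H for idfun}}
    (u v : H) :
  dot (- u) v = - dot u v.
Proof. by rewrite !(dot_sym _ v) dotNr. Qed.

Lemma dotBl {R : realType} {H : lmodType R} {dot : {dot H for idfun}}
    (u v w : H) :
  dot (u - v) w = dot u w - dot v w.
Proof. by rewrite !(dot_sym _ w) dotBr. Qed.

Lemma dot0l {R : realType} {H : lmodType R} {dot : {dot H for idfun}}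
    (u : H) : dot 0 u = 0.
Proof. by rewrite dot_sym dot0r. Qed.

Lemma dot_suml {R : realType} {H : lmodType R} {dot : {dot H for idfun}}
    (I : Type) (r : seq I) (u : H) (F : I -> H) :
  dot (\sum_(i <- r) F i) u = \sum_(i <- r) dot (F i) u.
Proof. by rewrite dot_sym dot_sumr; apply: eq_bigr => i _; rewrite dot_sym. Qed.

Lemma dot_self {R : realType} {H : normedModType R} {dot : {dot H for idfun}} :
  induces_norm dot -> forall u : H, dot u u = `|u| ^+ 2.
Proof.
move=> Hdot u; rewrite Hdot sqr_sqrtr//.
have [->|/(neq0_dnorm_gt0 (s := dot))/ltW//] := eqVneq u 0.
by rewrite dot0l.
Qed.

(** Cauchy-Schwarz comes from the triangle inequality, which the norm satisfies already: squaring it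
    and expanding [|u + v| ^+ 2] leaves the upper bound. Replacing [u] by [- u] gives the lower
    one. *)
Lemma dot_le_norm {R : realType} {H : normedModType R}
    {dot : {dot H for idfun}} :
  induces_norm dot -> forall u v : H, `|dot u v| <= `|u| * `|v|.
Proof.
move=> Hdot.
have ub (u v : H) : dot u v <= `|u| * `|v|.
  have := dot_self Hdot (u + v).
  rewrite dotDl !dotDr !(dot_self Hdot) (dot_sym v u).
  have : `|u + v| ^+ 2 <= (`|u| + `|v|) ^+ 2.
    by rewrite lerXn2r// ?nnegrE// ?ler_normD// addr_ge0.
  nra.
move=> u v; rewrite ler_norml ub andbT lerNl.
by have := ub (- u) v; rewrite dotNl normrN.
Qed.

Lemma dot_linear {R : realType} {H : lmodType R} {dot : {dot H for idfun}}
  (a : H) : linear (dot a : H -> R^o).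
Proof. by move=> c u v; rewrite dotDr dotZr. Qed.

Lemma bounded_fun_norm_dot {R : realType} {H : normedModType R}
    {dot : {dot H for idfun}} (Hdot : induces_norm dot) (a : H) :
  bounded_fun_norm (dot a : H -> R^o).
Proof.
move=> r; exists (`|a| * r) => u ur.
by rewrite (le_trans (dot_le_norm Hdot a u))// ler_wpM2l.
Qed.

(** By Cauchy-Schwarz, [dot a] is a bounded, hence continuous, linear functional, so weak
    convergence may be tested on it. *)
Lemma weak_cvg_dot {R : realType} {H : normedModType R}
    {dot : {dot H for idfun}} (Hdot : induces_norm dot)
    (a : H) {u : nat -> H} {l : H} :
  weak_cvg u l -> (fun k => dot a (u k)) @ \oo --> dot a l.
Proof.
pose f : {linear H -> R^o} :=
  HB.pack (dot a : H -> R^o)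
    (GRing.isLinear.Build _ _ _ _ _ (dot_linear (dot := dot) a)).
suff fc : continuous f by move=> /(_ f fc).
apply/linear_bounded_continuous/linear_boundedP.
near=> r => v; apply: (le_trans (dot_le_norm Hdot a v)).
by rewrite ler_wpM2r.
Unshelve. all: by end_near. Qed.

(** The functionals [dot (u k)] are pointwise bounded, since their values at each point converge.
    The uniform boundedness principle bounds them on the unit ball. *)
Lemma weak_cvg_bounded {R : realType} {H : completeNormedModType R}
    {dot : {dot H for idfun}} (Hdot : induces_norm dot)
    {u : nat -> H} {l : H} :
  weak_cvg u l -> exists M : R, forall k, `|u k| <= M.
Proof.
move=> ul; pose F : set (H -> R^o) := range (fun k => dot (u k)).
have [|v|M uM] := @Banach_Steinhauss R H R^o F _ _ 1.
- move=> _ [k _ <-]; split; first exact: bounded_fun_norm_dot.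
  exact: dot_linear.
- have /cvgP/cvg_seq_bounded [M [_ Mb]] := weak_cvg_dot Hdot v ul.
  exists (M + 1) => _ [k _ <-]; rewrite dot_sym.
  by apply: (Mb (M + 1)) => //; rewrite ltrDl.
exists M => k.
(* The functional [dot (u k)] takes the value [|u k|] at the normalized vector [u k]; a zero vector
   cannot be normalized and only needs [0 <= M]. *)
have [u0|u0] := eqVneq (u k) 0.
  have := uM (dot (u k)) (imageT _ k) 0; rewrite normr0 => /(_ ler01).
  by rewrite u0 normr0 dot0r normr0.
have nu0 : 0 < `|u k| by rewrite normr_gt0.
have := uM (dot (u k)) (imageT _ k) (`|u k|^-1 *: u k).
rewrite normrZ normfV normr_id mulVf ?gt_eqF// => /(_ (lexx _)).
rewrite dotZr dot_self//= expr2 mulKf ?gt_eqF//.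
by rewrite normr_id.
Qed.

(** Split [u k] as [(u k - a) + a]: the first part contributes at most [|u k - a| * M], with [M] a
    bound on the weakly convergent factor, and the second is a fixed functional. *)
Lemma cvg_dot {R : realType} {H : completeNormedModType R}
    {dot : {dot H for idfun}} (Hdot : induces_norm dot)
    {u v : nat -> H} {a b : H} :
  u @ \oo --> a -> weak_cvg v b ->
  (fun k => dot (u k) (v k)) @ \oo --> dot a b.
Proof.
move=> ua vb; have [M vM] := weak_cvg_bounded Hdot vb.
have ua0 : (fun k => `|u k - a|) @ \oo --> (0 : R).
  by apply/norm_cvg0P/subr_cvg0.
rewrite -[dot a b]add0r.
under eq_fun => k do rewrite -{1}(subrK a (u k)) dotDl.
apply: cvgD; last exact: weak_cvg_dot.
apply: norm_cvg0.
apply: (@squeeze_cvgr _ _ _ _ (fun=> 0) (fun k => `|u k - a| * M)).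
- apply: nearW => k; rewrite normr_ge0/=.
  by rewrite (le_trans (dot_le_norm Hdot _ _))// ler_wpM2l.
- exact: cvg_cst.
- by rewrite -[0](mul0r M); apply: cvgMl.
Qed.

Lemma weak_cvgB {R : realType} {H : normedModType R} (u v : nat -> H)
    (a b : H) :
  weak_cvg u a -> weak_cvg v b -> weak_cvg (fun k => u k - v k) (a - b).
Proof.
move=> ua vb f cf; rewrite linearB.
under eq_fun do rewrite linearB.
by apply: cvgB; [exact: ua|exact: vb].
Qed.

Lemma weak_cvgZ {R : realType} {H : normedModType R} (c : R) (u : nat -> H)
    (a : H) :
  weak_cvg u a -> weak_cvg (fun k => c *: u k) (c *: a).
Proof.
move=> ua f cf; rewrite linearZ.
under eq_fun do rewrite linearZ.
by apply: cvgZr; exact: ua.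
Qed.

Lemma weak_cvg_cst {R : realType} {H : normedModType R} (a : H) :
  weak_cvg (fun=> a) a.
Proof. by move=> f _; exact: cvg_cst. Qed.

(** With [d = u - v] and [e = N u - N v], the two factors are [(d - e) / 2] and [(d + e) / 2], so
    their product is [(|d|^2 - |e|^2) / 4]. *)
Lemma conically_averaged_monotone {R : realType} {H : normedModType R}
    {dot : {dot H for idfun}} (Hdot : induces_norm dot)
    (theta : R) (T : H -> H) (F := fun u => (2 * theta)^-1 *: (u - T u)) :
  0 < theta -> conically_averaged theta T ->
  forall u v, 0 <= dot (F u - F v) ((u - F u) - (v - F v)).
Proof.
move=> theta0 [N Nne TE] u v.
have FE w : F w = 2^-1 *: (w - N w).
  rewrite /F TE scalerBl scale1r opprD addrA subKr -scalerBr scalerA.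
  by rewrite invfM -mulrA mulVf ?gt_eqF// mulr1.
have GE w : w - F w = 2^-1 *: (w + N w).
  have {1}-> : w = 2^-1 *: (w + w).
    have h : 2^-1 + 2^-1 = 1 :> R by lra.
    by rewrite scalerDr -scalerDl h scale1r.
  by rewrite FE -scalerBr opprB -addrA [w + (_ - _)]addrC subrK.
have -> : F u - F v = 2^-1 *: ((u - v) - (N u - N v)).
  by rewrite !FE -scalerBr !opprD addrACA.
have -> : u - F u - (v - F v) = 2^-1 *: ((u - v) + (N u - N v)).
  by rewrite !GE -scalerBr opprD addrACA.
rewrite dotZl dotZr/= mulrA mulr_ge0 ?mulr_ge0 ?invr_ge0//.
have : `|N u - N v| ^+ 2 <= `|u - v| ^+ 2 by rewrite lerXn2r// nnegrE.
move: (u - v) (N u - N v) => d e de.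
by rewrite dotBl !dotDr !(dot_self Hdot) (dot_sym e d); lra.
Qed.

Lemma monotone_sum_limit {R : realType} {H : completeNormedModType R}
    {dot : {dot H for idfun}} (Hdot : induces_norm dot) (n : nat) (i0 : 'I_n)
    (ps qs : 'I_n -> nat -> H) (p a b : 'I_n -> H) (q : H) :
  (forall i, weak_cvg (ps i) (p i)) ->
  weak_cvg (qs i0) q ->
  (fun k => \sum_(i < n) ps i k) @ \oo --> \sum_(i < n) p i ->
  (forall i, (fun k => qs i k - qs i0 k) @ \oo --> (0 : H)) ->
  (forall i k, 0 <= dot (ps i k - a i) (qs i k - b i)) ->
  0 <= \sum_(i < n) dot (p i - a i) (q - b i).
Proof.
move=> psp qsq sump dq mono.
pose s k := \sum_(i < n) dot (ps i k - a i) (qs i k - b i).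
(* Write [qs i k] as [(qs i k - qs i0 k) + qs i0 k]. The common vector [qs i0 k] leaves the sum,
   where it meets the strongly convergent sum of the [ps i k]. *)
have sE k : s k = \sum_(i < n) dot (ps i k - a i) (qs i k - qs i0 k)
    + dot (\sum_(i < n) ps i k - \sum_(i < n) a i) (qs i0 k)
    - \sum_(i < n) dot (ps i k - a i) (b i).
  rewrite -sumrB dot_suml -big_split -sumrB /=; apply: eq_bigr => i _.
  by rewrite -dotDr -dotBr subrK.
have pa i : weak_cvg (fun k => ps i k - a i) (p i - a i).
  by apply: weak_cvgB => //; exact: weak_cvg_cst.
have scvg : s @ \oo --> \sum_(i < n) dot (p i - a i) (q - b i).
  have -> : \sum_(i < n) dot (p i - a i) (q - b i) =
      0 + dot (\sum_(i < n) p i - \sum_(i < n) a i) q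
      - \sum_(i < n) dot (p i - a i) (b i).
    rewrite add0r -sumrB dot_suml -sumrB; apply: eq_bigr => i _.
    by rewrite -dotBr.
  rewrite (funext sE); apply: cvgB; first apply: cvgD.
  (* Each error term pairs a strongly null factor with a weakly convergent one. *)
  - rewrite [X in _ --> X](_ : 0 = \sum_(i < n) dot 0 (p i - a i)); last first.
      by rewrite big1// => i _; rewrite dot0l.
    apply: cvg_big => [|i _]; first exact: add_continuous.
    under eq_fun do rewrite dot_sym.
    exact: cvg_dot.
  - apply: cvg_dot => //; apply: cvgB => //; exact: cvg_cst.
  - apply: cvg_big => [|i _]; first exact: add_continuous.
    rewrite dot_sym; under eq_fun do rewrite dot_sym.
    exact: weak_cvg_dot.
rewrite -(cvg_lim _ scvg)//; apply: limr_ge; first exact: cvgP scvg.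
apply: nearW => k.
by apply: sumr_ge0 => i _; exact: mono.
Qed.

Theorem theorem3p3 (R : realType) (H : completeNormedModType R)
  (dot : {dot H for idfun}) (Hdot : induces_norm dot)
  (n : nat) (Hn : (2 <= n)%N)
  (theta : 'I_n -> R) (Htheta : forall i : 'I_n, 0 < theta i)
  (T : 'I_n -> H -> H)
  (HT : forall i : 'I_n, conically_averaged (theta i) (T i))
  (xs : 'I_n -> nat -> H) (x : 'I_n -> H) (y : H)
  (Hx : forall i : 'I_n, weak_cvg (xs i) (x i))
  (HTx : forall i : 'I_n,
    weak_cvg (fun k : nat => T i (xs i k))
      ((2 * theta i) *: y + (1 - 2 * theta i) *: x i))
  (Hsum : (fun k : nat =>
      \sum_(i < n) (2 * theta i)^-1 *: (xs i k - T i (xs i k))) @ \oo -->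
    - (n%:R *: y) + \sum_(i < n) x i)
  (Hdiff : forall i j : 'I_n,
    (fun k : nat => (xs i k - xs j k)
      - ((2 * theta i)^-1 *: (xs i k - T i (xs i k))
         - (2 * theta j)^-1 *: (xs j k - T j (xs j k)))) @ \oo --> (0 : H)) :
  forall i : 'I_n,
    T i (x i) = (2 * theta i) *: y + (1 - 2 * theta i) *: x i.
Proof.
pose F i u := (2 * theta i)^-1 *: (u - T i u).
have t0 i : 2 * theta i != 0 by rewrite mulf_neq0// gt_eqF.
have Fx i : weak_cvg (fun k => F i (xs i k)) (x i - y).
  have -> : x i - y = (2 * theta i)^-1 *:
      (x i - ((2 * theta i) *: y + (1 - 2 * theta i) *: x i)).
    rewrite scalerBl scale1r addrCA -(opprB (_ *: x i)) subKr -scalerBr scalerA.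
    by rewrite mulVf// scale1r.
  exact/weak_cvgZ/weak_cvgB.
move=> i0.
have : 0 <= \sum_(i < n) dot (x i - y - F i (x i)) (y - (x i - F i (x i))).
  (* Here [a i] is [F i (x i)] and [b i] is [x i - F i (x i)], so monotonicity compares [xs i k]
     with [x i]. *)
  apply: (@monotone_sum_limit R H dot Hdot n i0 (fun i k => F i (xs i k))
      (fun i k => xs i k - F i (xs i k))) => //.
  - by rewrite -[y](subKr (x i0)); exact: weak_cvgB.
  - by rewrite sumrB sumr_const card_ord -scaler_nat addrC.
  - move=> i; apply: cvg_trans (Hdiff i i0); apply: near_eq_cvg.
    apply: nearW => k; rewrite /F.
    by rewrite !opprD addrACA.
  - move=> i k; exact: (conically_averaged_monotone Hdot).
under eq_bigr => i _.
  rewrite (_ : y - _ = - (x i - y - F i (x i))); last first.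
    by rewrite !opprB addrA addrAC [LHS]addrC addrA.
  rewrite dotNr dot_self//; over.
rewrite sumrN oppr_ge0 => le0.
have /eqP : \sum_(i < n) `|x i - y - F i (x i)| ^+ 2 == 0.
  by rewrite eq_le le0 sumr_ge0// => i _; rewrite sqr_ge0.
move/eqP; rewrite psumr_eq0// => /allP/(_ i0 (mem_index_enum _)).
(* The vanishing square gives [x i0 - y = F i0 (x i0)]; multiplying by [2 * theta i0] turns the
   right side into [x i0 - T i0 (x i0)]. *)
rewrite sqrf_eq0 normr_eq0 subr_eq0 => /eqP /(congr1 ( *:%R (2 * theta i0))).
rewrite /F scalerA divff// scale1r => h.
by rewrite -[LHS](subKr (x i0)) -h scalerBl scale1r scalerBr opprB addrCA.
Qed.
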